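(* Let Assumptions 1 (convexity and solvability) and 2 (network) stated in the context hold, and let $\boldsymbol{z}^k,\boldsymbol{q}^k$ be the stacked iterates of the Proximal-Tracking algorithm with step size $c>0$ defined in the context, with $\boldsymbol{y}^k:=\sum_{t=0}^k(I-W)\boldsymbol{z}^t$. Then for all $k\ge0$, $$\boldsymbol{z}^{k+1}=W^2\boldsymbol{z}^k-c\,\boldsymbol{q}^{k+1}-(I-W)\boldsymbol{y}^k,$$ $$\boldsymbol{y}^{k+1}=\boldsymbol{y}^k+(I-W)\boldsymbol{z}^{k+1}.$$
   Context: Problem. $N$ agents, functions $f_i:\mathbb{R}^n\to\mathbb{R}$ and sets $Z_i\subseteq\mathbb{R}^n$, $i=1,\dots,N$; minimize $\sum_i f_i(z)$ over $z\in\bigcap_i Z_i$. Assumption 1: each $f_i$ is convex and lower semicontinuous, each $Z_i$ is convex and closed, and the problem has at least one optimal solution. Assumption 2: the communication graph $\mathcal{G}=(\{1,\dots,N\},\mathcal{E})$ is undirected and connected, and $\mathcal{W}=(w_{ij})\in\mathbb{R}^{N\times N}$, with $w_{ij}>0$ if $(i,j)\in\mathcal{E}$ and $w_{ij}=0$ otherwise, is symmetric, doubly stochastic and positive definite (so the pairs $(i,i)$ are in $\mathcal{E}$). Notation: $W:=\mathcal{W}\otimes I_n$, $I$ is the identity of size $Nn$. Proximal-Tracking algorithm (step size $c>0$): start from $z_i^0=g_i^0=q_i^0=0\in\mathbb{R}^n$; for $k=0,1,\dots$ and each $i$, put $\xi_i^k=\sum_{j}w_{ij}z_j^k$, $\iota_i^k=\sum_j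 w_{ij}g_j^k$, $z_i^{k+1}=\arg\min_{z_i\in Z_i}\{f_i(z_i)+(\iota_i^k-q_i^k)^\top z_i+\frac{1}{2c}\|z_i-\xi_i^k\|^2\}$, $q_i^{k+1}=\frac1c(\xi_i^k-z_i^{k+1})+q_i^k-\iota_i^k$, $g_i^{k+1}=\iota_i^k+q_i^{k+1}-q_i^k$. Stack: $\boldsymbol{z}^k=(z_1^k,\dots,z_N^k)\in\mathbb{R}^{Nn}$, $\boldsymbol{q}^k=(q_1^k,\dots,q_N^k)\in\mathbb{R}^{Nn}$. *)

(* Defs.v *)
From HB Require Import structures.
From mathcomp Require Import all_boot all_order all_algebra.
From mathcomp Require Import all_classical all_reals all_analysis.
From mathcomp Require Export mxtens.

Set Implicit Arguments.
Unset Strict Implicit.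
Unset Printing Implicit Defensive.

Import Order.TTheory GRing.Theory Num.Theory.
Import numFieldNormedType.Exports.

Local Open Scope classical_set_scope.
Local Open Scope ring_scope.

Definition argmin (R : realType) (T : Type) (D : set T) (F : T -> R) : set T :=
  [set x | D x /\ forall y, D y -> F x <= F y].

Definition dotv (R : realType) (n : nat) (u v : 'cV[R]_n) : R :=
  \sum_i u i ord0 * v i ord0.

(* The library's norm on matrices is the sup norm, hence a separate
   Euclidean norm; both induce the topology of ['cV[R]_n]. *)
Definition enorm (R : realType) (n : nat) (u : 'cV[R]_n) : R :=
  Num.sqrt (dotv u u).

Record convex_solvable (R : realType) (N n : nat)
    (f : 'I_N -> 'cV[R]_n -> R) (Z : 'I_N -> set 'cV[R]_n) : Prop := {
  cost_convex : forall i,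
    convex_function (setT : set (convex_lmodType 'cV[R]_n)) (f i);
  cost_lsc : forall i, lower_semicontinuous (fun x => (f i x)%:E);
  constr_convex : forall i,
    convex_set (Z i : set (convex_lmodType 'cV[R]_n));
  constr_closed : forall i, closed (Z i);
  solvable_problem :
    argmin (\bigcap_i Z i) (fun x => \sum_i f i x) !=set0
}.

Definition doubly_stochastic (R : realType) (N : nat) (w : 'M[R]_N) : Prop :=
  [/\ forall i j, 0 <= w i j,
      forall i, \sum_j w i j = 1 &
      forall j, \sum_i w i j = 1].

Definition positive_definite (R : realType) (N : nat) (w : 'M[R]_N) : Prop :=
  w^T = w /\ forall x : 'cV[R]_N, x != 0 -> 0 < dotv x (w *m x).

(* The edge relation [E] may (and, [w] being positive definite, must) contain
   all the self-loops. *)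
Record network (R : realType) (N : nat) (E : rel 'I_N) (w : 'M[R]_N) : Prop := {
  graph_undirected : symmetric E;
  graph_connected : forall i j, connect E i j;
  weight_edge : forall i j, E i j -> 0 < w i j;
  weight_nonedge : forall i j, ~~ E i j -> w i j = 0;
  weight_sym : w^T = w;
  weight_stoch : doubly_stochastic w;
  weight_posdef : positive_definite w
}.

Definition mix (R : realType) (N n : nat) (w : 'M[R]_N)
    (x : 'I_N -> 'cV[R]_n) (i : 'I_N) : 'cV[R]_n :=
  \sum_j w i j *: x j.

(* [z k i], [g k i], [q k i] are the local variables of agent [i] at
   iteration [k]; [mix w (z k) i] and [mix w (g k) i] are xi_i^k and iota_i^k.
   The objective of the local problem is strongly convex, so that its argmin
   has at most one element. *)
Record proximal_tracking (R : realType) (N n : nat)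
    (f : 'I_N -> 'cV[R]_n -> R) (Z : 'I_N -> set 'cV[R]_n)
    (w : 'M[R]_N) (c : R) (z g q : nat -> 'I_N -> 'cV[R]_n) : Prop := {
  pt_z0 : forall i, z 0%N i = 0;
  pt_g0 : forall i, g 0%N i = 0;
  pt_q0 : forall i, q 0%N i = 0;
  pt_z : forall k i,
    argmin (Z i)
      (fun x => f i x + dotv (mix w (g k) i - q k i) x
                + (2 * c)^-1 * enorm (x - mix w (z k) i) ^+ 2)
      (z k.+1 i);
  pt_q : forall k i,
    q k.+1 i = c^-1 *: (mix w (z k) i - z k.+1 i) + q k i - mix w (g k) i;
  pt_g : forall k i,
    g k.+1 i = mix w (g k) i + q k.+1 i - q k i
}.

(* Agent-major stacking: entry [j] of [x i] is at position [i * n + j], which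
   is the index convention of the Kronecker product [*t]. *)
Definition stack (R : realType) (N n : nat) (x : 'I_N -> 'cV[R]_n) :
    'cV[R]_(N * n) :=
  \col_a x (mxtens_unindex a).1 (mxtens_unindex a).2 ord0.

Definition kronW (R : realType) (N : nat) (n : nat) (w : 'M[R]_N) :
    'M[R]_(N * n) :=
  w *t (1%:M : 'M[R]_n).

Definition ysum (R : realType) (N n : nat) (w : 'M[R]_N)
    (z : nat -> 'I_N -> 'cV[R]_n) (k : nat) : 'cV[R]_(N * n) :=
  \sum_(0 <= t < k.+1) (1%:M - kronW n w) *m stack (z t).

(* Main.v *)
(* The updates of [q] and [g] amount to the linear relations
     z^{k+1} = W z^k + c (q^k - q^{k+1} - W g^k),
     c g^{k+1} = W z^k - z^{k+1}.
   Eliminating [g] yields z^{k+2} + c q^{k+2} = 2 W z^{k+1} - W^2 z^k + c q^{k+1},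
   which is the difference of the claim at two consecutive indices because
   I + W^2 - (I - W)^2 = 2 W. *)
Require Import Defs.
From HB Require Import structures.
From mathcomp Require Import all_boot all_order all_algebra.
From mathcomp Require Import all_classical all_reals all_analysis.
From mathcomp Require Import ring.

Set Implicit Arguments.
Unset Strict Implicit.
Unset Printing Implicit Defensive.

Import Order.TTheory GRing.Theory Num.Theory.
Import numFieldNormedType.Exports.

Local Open Scope classical_set_scope.
Local Open Scope ring_scope.

Lemma stackD (R : realType) (N n : nat) (x x' : 'I_N -> 'cV[R]_n) :
  stack (fun i => x i + x' i) = stack x + stack x'.
Proof. by apply/matrixP => a b; rewrite !mxE. Qed.

Lemma stackB (R : realType) (N n : nat) (x x' : 'I_N -> 'cV[R]_n) :
  stack (fun i => x i - x' i) = stack x - stack x'.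
Proof. by apply/matrixP => a b; rewrite !mxE. Qed.

Lemma stackZ (R : realType) (N n : nat) (a : R) (x : 'I_N -> 'cV[R]_n) :
  stack (fun i => a *: x i) = a *: stack x.
Proof. by apply/matrixP => i b; rewrite !mxE. Qed.

Lemma eq_stack (R : realType) (N n : nat) (x x' : 'I_N -> 'cV[R]_n) :
  x =1 x' -> stack x = stack x'.
Proof. by move=> xx'; apply/matrixP => a b; rewrite !mxE xx'. Qed.

Lemma stack0 (R : realType) (N n : nat) (x : 'I_N -> 'cV[R]_n) :
  (forall i, x i = 0) -> stack x = 0.
Proof. by move=> x0; apply/matrixP => a b; rewrite !mxE x0 mxE. Qed.

(** Splitting the column index of [kronW n w] into a pair (agent, coordinate) turns each row into a
    double sum, and the identity factor keeps only the coordinate of that row. *)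
Lemma stack_mix (R : realType) (N n : nat) (w : 'M[R]_N)
    (x : 'I_N -> 'cV[R]_n) :
  stack (mix w x) = kronW n w *m stack x.
Proof.
apply/matrixP => a b; rewrite !mxE summxE.
rewrite (reindex (fun p => mxtens_index p)) /=; last first.
  exists (@mxtens_unindex _ _) => p _.
    exact: mxtens_indexK.
  exact: mxtens_unindexK.
under [RHS]eq_bigr => p _ do rewrite !mxE mxtens_indexK.
rewrite -(pair_bigA _ (fun i j => w (mxtens_unindex a).1 i
  * ((mxtens_unindex a).2 == j)%:R * x i j ord0)) /=.
apply: eq_bigr => i _; rewrite mxE (bigD1 (mxtens_unindex a).2) //= eqxx mulr1.
by rewrite big1 ?addr0 // => j; rewrite eq_sym => /negPf ->; rewrite mulr0 mul0r.
Qed.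

Theorem lemma4 (R : realType) (N n : nat)
    (f : 'I_N -> 'cV[R]_n -> R) (Z : 'I_N -> set 'cV[R]_n)
    (E : rel 'I_N) (w : 'M[R]_N) (c : R)
    (z g q : nat -> 'I_N -> 'cV[R]_n)
    (hprob : convex_solvable f Z)
    (hnet : network E w)
    (hc : 0 < c)
    (halg : proximal_tracking f Z w c z g q)
    (k : nat) :
  let W := kronW n w in
  let y := ysum w z in
  stack (z k.+1) =
    W ^+ 2 *m stack (z k) - c *: stack (q k.+1) - (1%:M - W) *m y k
  /\ y k.+1 = y k + (1%:M - W) *m stack (z k.+1).
Proof.
move=> W y; have c0 : c != 0 by rewrite gt_eqF.
have yS m : y m.+1 = y m + (1%:M - W) *m stack (z m.+1).
  by rewrite /y /ysum big_nat_recr.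
split=> //.
(* The [q] update solved for [z m.+1]. *)
have zS m : stack (z m.+1) =
    W *m stack (z m) + c *: (stack (q m) - stack (q m.+1) - W *m stack (g m)).
  rewrite -!stack_mix -!stackB -stackZ -stackD; apply: eq_stack => i.
  rewrite (pt_q halg); set u := mix w (z m) i; set v := mix w (g m) i.
  apply/matrixP => a b; rewrite !mxE; field; exact: c0.
(* Inserting the [q] update into the [g] update cancels both [mix w (g m) i] and [q m i]. *)
have gS m : c *: stack (g m.+1) = W *m stack (z m) - stack (z m.+1).
  rewrite -!stack_mix -!stackB -stackZ; apply: eq_stack => i.
  rewrite (pt_g halg) (pt_q halg).
  apply/matrixP => a b; rewrite !mxE; field; exact: c0.
elim: k => [|m IHm].
  (* The zero start reduces both sides to [- c *: stack (q 1)]. *)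
  rewrite zS /y /ysum big_nat1 (stack0 (pt_z0 halg)) (stack0 (pt_q0 halg)).
  rewrite (stack0 (pt_g0 halg)).
  by rewrite !mulmx0 !(add0r, subr0) scalerN.
(* The induction hypothesis solved for its [y] term, so that no [y] remains after [yS]. *)
have y_m : (1%:M - W) *m y m =
    W ^+ 2 *m stack (z m) - c *: stack (q m.+1) - stack (z m.+1).
  by rewrite [in RHS]IHm; apply/matrixP => a b; rewrite !mxE; ring.
rewrite zS scalerBr scalemxAr gS yS !mulmxDr y_m mulmxN.
rewrite !(mulmxBl, mulmxBr, mul1mx) expr2 -!mulmxA.
(* Generalizing the products stops [mxE] from expanding them into sums; what is left is linear in
   the entries. *)
move: (W *m (W *m stack (z m))) (W *m (W *m stack (z m.+1))) => WWz WWz'.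
move: (W *m stack (z m.+1)) => Wz'.
by apply/matrixP => a b; rewrite !mxE; ring.
Qed.
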